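(* Let $P:\mathcal{S}\times\mathbb{R}^{\dim(\beta)}\to\mathcal{S}$ be the Poincaré map of the closed-loop biped defined in the context, and let $(x^*,0)$ be a fixed point of $P(x,\beta)$, i.e. $x^*\in\mathcal{S}$ and $P(x^*,0)=x^*$. If $\frac{\partial P}{\partial x}\big|_{(x^*,0)}$ does not have an eigenvalue at $1$, then there exists a $\delta>0$ such that for each $\beta\in B_\delta(0)\subset\mathbb{R}^{\dim(\beta)}$ there is a unique solution of $P(x,\beta)=x$, given by $x=\mathrm{x}^*(\beta)$. Further, $\mathrm{x}^*(\beta)$ is continuous for $\beta\in B_\delta(0)$.
   Context: Model. A planar biped with two legs with knees, a torso and one degree of underactuation has configuration $q=(q_1,\dots,q_5)\in Q$ and state $x=(q,\dot q)\in TQ=\{(q,\dot q): q\in Q,\ \dot q\in\mathbb{R}^5\}$. The swing-phase dynamics $D(q)\ddot q+C(q,\dot q)\dot q+G(q)=Bu$ ($D$ inertia matrix, $C$ Coriolis matrix, $G$ gravity vector, $B$ the matrix mapping the actuator inputs $u$ to generalized forces) is written in state-space form as $\dot x=f(x)+g(x)u$. With $p_{\rm v}(q)$ the height of the swing foot, the switching surface is $\mathcal{S}=\{(q,\dot q)\in TQ: p_{\rm v}(q)=0,\ \dot p_{\rm v}(q,\dot q)<0\}$, and $x^+=\Delta(x^-)$, with $\Delta:\mathcal{S}\to TQ$, is the impact map taking the state just before foot impact to the state just after it (the legs exchange roles at impact). Outputs. Let $q_{\rm a}=(q_2,q_3,q_4,q_5)$ be the controlled joints and $\theta(q)=q_1+q_2+\frac12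 q_4$; attention is restricted to gaits in which $\theta$ increases monotonically during a step, from $\theta^+$ (post-impact, beginning of the step) to $\theta^-$ (pre-impact, end of the step). For a parameter $\beta\in\mathbb{R}^{\dim(\beta)}$ the output is $h_\beta(q)=q_{\rm a}-h_{\rm d}(\theta(q))-h_{\rm s}(\theta(q),\beta)$. Here $h_{\rm d}$ is a given function of $\theta$ (nominal gait), designed so that, with $h(q)=q_{\rm a}-h_{\rm d}(\theta(q))$, the surface $\mathcal{Z}=\{(q,\dot q)\in TQ: h(q)=0,\ L_fh(q,\dot q)=0\}$ is invariant under impact, i.e. $\Delta(\mathcal{S}\cap\mathcal{Z})\subset\mathcal{Z}$. The term $h_{\rm s}(\theta,\beta)$ is a (piecewise) polynomial in $\theta$ with coefficients depending on $\beta$ such that $h_{\rm s}(\theta,0)=0$ for $\theta^+\le\theta\le\theta^-$ and, with $\theta_{\rm s}=\theta^++0.9(\theta^--\theta^+)$, for all $\beta$: $h_{\rm s}(\theta^+,\beta)=0$ and $\frac{\partial h_{\rm s}}{\partial\theta}(\theta^+,\beta)=0$; $h_{\rm s}(\theta_{\rm s},\beta)=0$ and $\frac{\partial^i h_{\rm s}}{\partial\theta^i}(\theta_{\rm s},\beta)=0$ for $i=1,2$; $h_{\rm s}(\theta,\beta)=0$ for $\theta_{\rm s}\le\theta\le\theta^-$. Closed loop. The control law is $u_\beta^*(x)=-\big(L_gL_fh_\beta(x)\big)^{-1}L_f^2h_\beta(x)$, where $L_f,L_g$ denote Lie derivatives along $f,g$ (the matrix $L_gL_fh_\beta$ is taken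 to be invertible where used). The closed-loop hybrid system flows by $\dot x=f(x)+g(x)u_\beta^*(x)$ for $x\notin\mathcal{S}$ and jumps by $x^+=\Delta(x^-)$ for $x^-\in\mathcal{S}$. Poincaré map. Let $\varphi_\beta(t,x)$ be the maximal solution of the closed-loop continuous dynamics starting at $x$ at the starting time $t_k$ of the $k$-th step, and let $T_I(x,\beta)=\inf\{t\ge t_k:\varphi_\beta(t,\Delta(x))\in\mathcal{S}\}$ be the time-to-impact function. Then $P(x,\beta)=\varphi_\beta(T_I(x,\beta),\Delta(x))$. It is assumed that there is a limit cycle for $\beta=0$ (the ''base'' limit cycle), so that $P(x^*,0)=x^*$, and that the function $(x,\beta)\mapsto P(x,\beta)-x$ is continuously differentiable. $\frac{\partial P}{\partial x}|_{(x^*,0)}$ is the linearization at $x^*$ of the map $x\mapsto P(x,0)$ from $\mathcal{S}$ to itself. $B_\delta(0)$ is the ball of radius $\delta$ about $0$.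
   Formalization: The solution of P(x,β)=x is claimed unique only in a fixed neighbourhood of x* in S, the same for all β in the ball; uniqueness over all of S fails in general, since P(·,0) may have several fixed points. *)

(* Defs.v *)
From HB Require Import structures.
From mathcomp Require Import all_boot all_order all_algebra.
From mathcomp Require Import all_classical all_reals all_analysis.

Set Implicit Arguments.
Unset Strict Implicit.
Unset Printing Implicit Defensive.

Import Order.TTheory GRing.Theory Num.Theory.
Import numFieldNormedType.Exports.

Local Open Scope classical_set_scope.
Local Open Scope ring_scope.

(** In finite dimension, continuity of every directional derivative is
    continuity of the differential for the operator norm. *)
Definition C1_on (R : realType) (V W : normedModType R) (U : set V)
    (f : V -> W) : Prop :=
  forall x, U x ->
    differentiable f x /\ (forall v, {for x, continuous (fun y => 'D_v f y)}).

(** Continuous differentiability on an embedded submanifold [A]: local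
    extendability to C^1 maps on open subsets of the ambient space. *)
Definition C1_on_submanifold (R : realType) (V W : normedModType R)
    (A : set V) (f : V -> W) : Prop :=
  forall x, A x -> exists (U : set V) (F : V -> W),
    [/\ open U, U x, C1_on U F & forall y, U y -> A y -> F y = f y].

(** [L] is the linearization at [x] of [f] seen as a map on [A] only.  When [A]
    is a submanifold, this determines [L] on the tangent space of [A] at [x];
    elsewhere [L] is arbitrary. *)
Definition is_linearization_within (R : realType) (V W : normedModType R)
    (A : set V) (f : V -> W) (x : V) (L : {linear V -> W}) : Prop :=
  forall e : R, 0 < e ->
    \forall y \near within A (nbhs x),
      `| f y - f x - L (y - x) | <= e * `| y - x |.

Definition has_eigenvalue_on (R : realType) (V : normedModType R)
    (T : set V) (L : V -> V) (l : R) : Prop :=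
  exists v : V, [/\ T v, v != 0 & L v = l *: v].

Definition piecewise_polynomial (R : realType) (n : nat) (s : seq R)
    (f : R -> 'cV[R]_n) : Prop :=
  forall a b : R, a < b -> (forall c, c \in s -> ~~ (a < c < b)) ->
    exists p : 'I_n -> {poly R},
      forall t, a < t < b -> f t = \col_i (p i).[t].

Definition twice_derivable (R : realType) (W : normedModType R)
    (f : R -> W) : Prop :=
  forall t : R, derivable f t 1 /\ derivable (derive1 f) t 1.

Definition lie (R : realType) (V W : normedModType R)
    (f : V -> V) (h : V -> W) : V -> W :=
  fun x => 'D_(f x) h x.

(** [g i x] is the [i]-th column of the input matrix [g(x)]. *)
Definition lie_mx (R : realType) (V : normedModType R) (m k : nat)
    (g : 'I_m -> V -> V) (h : V -> 'cV[R]_k) : V -> 'M[R]_(k, m) :=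
  fun x => \matrix_(i, j) (lie (g j) h x) i 0.

(** [phi] solves [x' = F x], [x t0 = x0] in [dom] on the interval [[t0, tau[];
    its values outside this interval are irrelevant. *)
Definition is_solution (R : realType) (V : normedModType R) (dom : set V)
    (F : V -> V) (t0 : R) (x0 : V) (tau : \bar R) (phi : R -> V) : Prop :=
  [/\ (t0%:E < tau)%E,
      phi t0 = x0,
      phi t @[t --> t0^'+] --> x0,
      (forall t, t0 <= t -> (t%:E < tau)%E -> dom (phi t)) &
      (forall t : R, t0 < t -> (t%:E < tau)%E ->
         is_derive t 1 phi (F (phi t)))].

Definition is_maximal_solution (R : realType) (V : normedModType R)
    (dom : set V) (F : V -> V) (t0 : R) (x0 : V) (tau : \bar R)
    (phi : R -> V) : Prop :=
  is_solution dom F t0 x0 tau phi /\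
  forall (sigma : \bar R) (psi : R -> V),
    is_solution dom F t0 x0 sigma psi ->
    (sigma <= tau)%E /\
    forall t, t0 <= t -> (t%:E < sigma)%E -> psi t = phi t.

(** States are pairs [(q, qdot)]. *)
Notation state R := ('cV[R]_5 * 'cV[R]_5)%type.

(** The values of [impact] matter only on the switching surface. *)
Record biped (R : realType) := Biped {
  config : set 'cV[R]_5;
  inertia : 'cV[R]_5 -> 'M[R]_5;
  coriolis : 'cV[R]_5 -> 'cV[R]_5 -> 'M[R]_5;
  gravity : 'cV[R]_5 -> 'cV[R]_5;
  actuation : 'M[R]_(5, 4);
  foot_height : 'cV[R]_5 -> R;
  impact : state R -> state R
}.

Definition TQ (R : realType) (M : biped R) : set (state R) :=
  [set x | config M x.1].

Definition switching (R : realType) (M : biped R) : set (state R) :=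
  [set x | [/\ TQ M x, foot_height M x.1 = 0 &
               'D_(x.2) (foot_height M) x.1 < 0]].

(** Tangent space of the switching surface at one of its points: the inequality
    in its definition is an open condition, and [foot_height] is a submersion
    where that inequality holds. *)
Definition switching_tangent (R : realType) (M : biped R) (x : state R) :
    set (state R) :=
  [set v | 'D_(v.1) (foot_height M) x.1 = 0].

Record biped_axioms (R : realType) (M : biped R) : Prop := BipedAxioms {
  config_open : open (config M);
  inertia_sym : forall q, config M q -> (inertia M q)^T = inertia M q;
  inertia_pos : forall q, config M q -> forall v : 'cV[R]_5, v != 0 ->
    0 < (v^T *m inertia M q *m v) 0 0;
  actuation_rank : \rank (actuation M) = 4%N;
  foot_height_C1 : C1_on (config M) (foot_height M);
  impact_TQ : forall x, switching M x -> TQ M (impact M x)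
}.

Definition drift (R : realType) (M : biped R) (x : state R) : state R :=
  (x.2, - (invmx (inertia M x.1) *m
           (coriolis M x.1 x.2 *m x.2 + gravity M x.1))).

Definition input_field (R : realType) (M : biped R) (i : 'I_4) (x : state R) :
    state R :=
  (0, invmx (inertia M x.1) *m col i (actuation M)).

(** One-based numbering of the joints. *)
Definition joint (R : realType) (q : 'cV[R]_5) (k : nat) : R :=
  q (inord k.-1) 0.

Definition controlled (R : realType) (q : 'cV[R]_5) : 'cV[R]_4 :=
  \col_(i < 4) joint q i.+2.

Definition theta (R : realType) (q : 'cV[R]_5) : R :=
  joint q 1 + joint q 2 + 2^-1 * joint q 4.

Record gait_design (R : realType) (p : nat) := GaitDesign {
  theta_plus : R;
  theta_minus : R;
  h_d : R -> 'cV[R]_4;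
  h_s : R -> 'cV[R]_p -> 'cV[R]_4
}.

Definition theta_s (R : realType) (p : nat) (g : gait_design R p) : R :=
  theta_plus g + 9%:R / 10%:R * (theta_minus g - theta_plus g).

Definition nominal_output (R : realType) (p : nat) (g : gait_design R p)
    (x : state R) : 'cV[R]_4 :=
  controlled x.1 - h_d g (theta x.1).

Definition output (R : realType) (p : nat) (g : gait_design R p)
    (b : 'cV[R]_p) (x : state R) : 'cV[R]_4 :=
  controlled x.1 - h_d g (theta x.1) - h_s g (theta x.1) b.

Definition zero_dynamics (R : realType) (M : biped R) (p : nat)
    (g : gait_design R p) : set (state R) :=
  [set x | [/\ TQ M x, nominal_output g x = 0 &
               lie (drift M) (nominal_output g) x = 0]].

(** Twice derivability is what the second-order Lie derivatives of the outputs
    require; the polynomial pieces of [h_s] have breakpoints that do not depend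
    on the parameter. *)
Record gait_axioms (R : realType) (M : biped R) (p : nat)
    (g : gait_design R p) : Prop := GaitAxioms {
  theta_lt : theta_plus g < theta_minus g;
  h_d_twice : twice_derivable (h_d g);
  impact_invariant : forall x,
    switching M x -> zero_dynamics M g x -> zero_dynamics M g (impact M x);
  h_s_poly : exists s : seq R,
    forall b, piecewise_polynomial s (fun t => h_s g t b);
  h_s_twice : forall b, twice_derivable (fun t => h_s g t b);
  h_s_nominal : forall t, theta_plus g <= t <= theta_minus g -> h_s g t 0 = 0;
  h_s_plus : forall b (i : nat), (i <= 1)%N ->
    derive1n i (fun t => h_s g t b) (theta_plus g) = 0;
  h_s_theta_s : forall b (i : nat), (i <= 2)%N ->
    derive1n i (fun t => h_s g t b) (theta_s g) = 0;
  h_s_end : forall b t, theta_s g <= t <= theta_minus g -> h_s g t b = 0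
}.

Definition decoupling (R : realType) (M : biped R) (p : nat)
    (g : gait_design R p) (b : 'cV[R]_p) : state R -> 'M[R]_4 :=
  lie_mx (input_field M) (lie (drift M) (output g b)).

Definition control (R : realType) (M : biped R) (p : nat)
    (g : gait_design R p) (b : 'cV[R]_p) (x : state R) : 'cV[R]_4 :=
  - (invmx (decoupling M g b x) *m
     lie (drift M) (lie (drift M) (output g b)) x).

Definition closed_loop (R : realType) (M : biped R) (p : nat)
    (g : gait_design R p) (b : 'cV[R]_p) (x : state R) : state R :=
  drift M x + \sum_(i < 4) control M g b x i 0 *: input_field M i x.

Definition closed_loop_dom (R : realType) (M : biped R) (p : nat)
    (g : gait_design R p) (b : 'cV[R]_p) : set (state R) :=
  [set x | TQ M x /\ decoupling M g b x \in unitmx].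

(** [phi b x0] is the maximal solution from [x0] at time [t0], and [tau b x0]
    the right end of its interval of existence. *)
Definition is_closed_loop_flow (R : realType) (M : biped R) (p : nat)
    (g : gait_design R p) (t0 : R)
    (tau : 'cV[R]_p -> state R -> \bar R)
    (phi : 'cV[R]_p -> state R -> R -> state R) : Prop :=
  forall b x0, closed_loop_dom M g b x0 ->
    is_maximal_solution (closed_loop_dom M g b) (closed_loop M g b) t0 x0
      (tau b x0) (phi b x0).

Definition impact_times (R : realType) (M : biped R) (p : nat) (t0 : R)
    (tau : 'cV[R]_p -> state R -> \bar R)
    (phi : 'cV[R]_p -> state R -> R -> state R)
    (x : state R) (b : 'cV[R]_p) : set R :=
  [set t | [/\ t0 <= t, (t%:E < tau b (impact M x))%E &
               switching M (phi b (impact M x) t)]].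

Definition time_to_impact (R : realType) (M : biped R) (p : nat) (t0 : R)
    (tau : 'cV[R]_p -> state R -> \bar R)
    (phi : 'cV[R]_p -> state R -> R -> state R)
    (x : state R) (b : 'cV[R]_p) : R :=
  inf (impact_times M t0 tau phi x b).

Definition poincare (R : realType) (M : biped R) (p : nat) (t0 : R)
    (tau : 'cV[R]_p -> state R -> \bar R)
    (phi : 'cV[R]_p -> state R -> R -> state R)
    (x : state R) (b : 'cV[R]_p) : state R :=
  phi b (impact M x) (time_to_impact M t0 tau phi x b).

(** The infimum in [time_to_impact] and the partial flow are total functions, so
    that [poincare] maps [S x R^p] to [S] is stated together with the conditions
    under which its value is meaningful. *)
Definition poincare_well_defined (R : realType) (M : biped R) (p : nat)
    (g : gait_design R p) (t0 : R)
    (tau : 'cV[R]_p -> state R -> \bar R)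
    (phi : 'cV[R]_p -> state R -> R -> state R) : Prop :=
  forall x b, switching M x ->
    [/\ closed_loop_dom M g b (impact M x),
        impact_times M t0 tau phi x b !=set0 &
        switching M (poincare M t0 tau phi x b)].

Definition monotone_step (R : realType) (M : biped R) (p : nat)
    (g : gait_design R p) (t0 : R)
    (tau : 'cV[R]_p -> state R -> \bar R)
    (phi : 'cV[R]_p -> state R -> R -> state R) (x : state R) : Prop :=
  let T := time_to_impact M t0 tau phi x 0 in
  let th t := theta (phi 0 (impact M x) t).1 in
  [/\ th t0 = theta_plus g, th T = theta_minus g &
      forall r t, t0 <= r -> r < t -> t <= T -> th r < th t].

(* Main.v *)
Require Import Defs.
From HB Require Import structures.
From mathcomp Require Import all_boot all_order all_algebra.
From mathcomp Require Import all_classical all_reals all_analysis.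
From mathcomp Require Import ring lra.

Set Implicit Arguments.
Unset Strict Implicit.
Unset Printing Implicit Defensive.

Import Order.TTheory GRing.Theory Num.Theory.
Import numFieldNormedType.Exports.

Local Open Scope classical_set_scope.
Local Open Scope ring_scope.

(** The fixed points of the Poincare map near [xstar] are found by an implicit
    function argument.  It cannot be applied to [P x b - x = 0] on the whole
    state space: the switching surface [S] is a hypersurface, the map is only
    known there, and an extension [F] of [P x b - x] to a neighbourhood has an
    uncontrolled derivative in the direction transverse to [S].

    Write [S] near [xstar] as the zero set of [h], the height of the swing foot
    as a function of the state.  Its differential [l] at [xstar] is nonzero,
    because the foot moves downwards: [l n = 1] for a multiple [n] of
    [(qdot, 0)].  The equation that is solved is [H x b = 0], where [H x b] is
    [F (x, b)] with its component along [n] replaced by [h x]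
    ([with_level]).

    - The partial derivative of [H] at [(xstar, 0)] is injective.  A vector [v]
      of its kernel satisfies [l v = 0], so it is tangent to [S]; there the
      derivative of [F] is [L - 1], since two linearizations of one map on [S]
      agree on tangent vectors ([linearization_tangent_unique], which rests on
      the existence of points of [S] in every tangent direction,
      [zero_set_tangent]).  The map [h \o P] vanishes on [S], so [l (L v) = 0]
      and the component along [n] vanishes as well; hence [L v = v], and
      [v = 0] because [1] is not an eigenvalue on the tangent space.
    - In finite dimension an injective derivative is invertible and a C^1 map
      is strictly differentiable ([C1_strictly_differentiable]), which makes the
      simplified Newton iteration a contraction, uniformly in the parameter
      ([implicit_function]).  This gives a unique zero of [H], which depends
      continuously on [b].
    - The zeros of [H] are the fixed points of [P].  A fixed point on [S] is
      plainly a zero.  Conversely [H x b = 0] forces [h x = 0], so [x] lies on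
      [S], and [P x b = x + s *: n] for a scalar [s]; both points lie on [S]
      and [h] is strictly monotone along [n], so [s = 0]. *)

(** * Completeness of products and matrices *)

HB.instance Definition _ (U V : puniformType) := Pointed.on (U * V)%type.

Lemma prod_complete (U V : completeType) (F : set_system (U * V)) :
  ProperFilter F -> cauchy F -> cvg F.
Proof.
move=> FF Fc.
have c1 : cvg (fst @ F).
  apply: cauchy_cvg => A /= entA.
  rewrite near_simpl -near2E near_map2.
  apply: Fc; exists (A, setT) => /=; first by split=> //; exact: entourageT.
  by move=> [[a b] [c d]] /= [Aac _]; exists ((a, c), (b, d)).
have c2 : cvg (snd @ F).
  apply: cauchy_cvg => A /= entA.
  rewrite near_simpl -near2E near_map2.
  apply: Fc; exists (setT, A) => /=; first by split=> //; exact: entourageT.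
  by move=> [[a b] [c d]] /= [_ Abd]; exists ((a, c), (b, d)).
apply/cvg_ex; exists (lim (fst @ F), lim (snd @ F)).
apply: cvg_trans (cvg_pair c1 c2).
by apply: near_eq_cvg; near=> x; rewrite -surjective_pairing.
Unshelve. all: by end_near. Qed.

HB.instance Definition _ (U V : completeType) :=
  Uniform_isComplete.Build (U * V)%type (@prod_complete U V).

(* The norm and the completeness of products and of matrices are declared
   separately; these instances join them. *)
HB.instance Definition _ (K : numFieldType) (U V : completeNormedModType K) :=
  Complete.on (U * V)%type.

HB.instance Definition _ (R : realType) (m n : nat) :=
  Complete.on (@matrix R m n).

(** * The implicit function theorem *)

(** The map [x |-> x - K (H x b)] is a contraction with ratio [1/2], because
    [K] inverts [J] and [H] differs from [J] by a map with Lipschitz constant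
    [1 / (2 k)].  Uniqueness and continuity come from the same estimate:
    [|x - y| <= 2 k |H x b - H y b|] near [x0]. *)
Lemma implicit_function (R : realType) (V : completeNormedModType R)
    (B : normedModType R) (H : V -> B -> V) (J K : {linear V -> V})
    (k r : R) (x0 : V) (b0 : B) :
  0 < k -> 0 < r -> cancel J K -> cancel K J ->
  (forall v, `|K v| <= k * `|v|) ->
  (forall x y b, `|x - x0| < r -> `|y - x0| < r -> `|b - b0| < r ->
     `|H x b - H y b - J (x - y)| <= (2 * k)^-1 * `|x - y|) ->
  (forall x b, `|x - x0| < r -> `|b - b0| < r -> {for b, continuous (H x)}) ->
  H x0 b0 = 0 ->
  exists (delta : R) (xs : B -> V), 0 < delta /\
    forall b, `|b - b0| < delta ->
      [/\ `|xs b - x0| < r, H (xs b) b = 0,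
          (forall x, `|x - x0| < r -> H x b = 0 -> x = xs b) &
          {for b, continuous xs}].
Proof.
move=> k0 r0 JK KJ Kk HJ Hc H00.
have kV : k * (2 * k)^-1 = 2^-1 by rewrite invfM mulrCA divff ?mulr1// gt_eqF.
have half_gt0 : 0 < 2^-1 :> R by [].
have dist x y b : `|x - x0| < r -> `|y - x0| < r -> `|b - b0| < r ->
    `|x - y - K (H x b - H y b)| <= 2^-1 * `|x - y|.
  move=> xr yr br; rewrite distrC -[x in _ - (x - _)]JK -[y in _ - (_ - y)]JK.
  rewrite -!linearB (le_trans (Kk _))// -kV -mulrA ler_wpM2l ?(ltW k0)//.
  exact: HJ.
have dist2 x y b : `|x - x0| < r -> `|y - x0| < r -> `|b - b0| < r ->
    `|x - y| <= 2 * k * `|H x b - H y b|.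
  move=> xr yr br; have := dist _ _ _ xr yr br => h.
  have := ler_normD (x - y - K (H x b - H y b)) (K (H x b - H y b)).
  rewrite subrK => h1; have h2 := Kk (H x b - H y b); lra.
have uniq x y b : `|x - x0| < r -> `|y - x0| < r -> `|b - b0| < r ->
    H x b = 0 -> H y b = 0 -> x = y.
  move=> xr yr br Hx Hy; apply/eqP; rewrite -subr_eq0 -normr_le0.
  by rewrite (le_trans (dist2 _ _ _ xr yr br))// Hx Hy subrr normr0 mulr0.
have x0r : `|x0 - x0| < r by rewrite subrr normr0.
have b0r : `|b0 - b0| < r by rewrite subrr normr0.
have [d1 d10 Hd] : exists2 d, 0 < d &
    forall b, `|b - b0| < d -> `|H x0 b| <= r / (4 * k).
  have /cvgrPdist_le/(_ (r / (4 * k))) := Hc _ _ x0r b0r.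
  rewrite divr_gt0 ?mulr_gt0// => /(_ isT) /nbhs_ballP[d /= d0 dH].
  exists d => // b bd; rewrite -normrN -sub0r -H00; apply: dH.
  by rewrite -ball_normE /= distrC.
pose d := Num.min d1 r.
have dr b : `|b - b0| < d -> `|b - b0| < r by rewrite lt_min => /andP[].
have ex b : exists x, `|b - b0| < d -> `|x - x0| < r /\ H x b = 0.
  have [bd|] := boolP (`|b - b0| < d); last by exists x0.
  (* The iteration stays in the ball of radius [r / 2]: it contributes at most
     [r / 4], and so does [K (H x0 b)] by the choice of [d1]. *)
  pose A := closed_ball_ (@Num.norm R V) x0 (r / 2).
  have Ar x : A x -> `|x - x0| < r.
    by rewrite /A /closed_ball_/= distrC => h; lra.
  have br := dr _ bd.
  have bd1 : `|b - b0| < d1 by move: bd; rewrite lt_min => /andP[].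
  have fA : {homo (fun x => x - K (H x b)) : x / A x}.
    move=> x Ax; have := dist _ _ _ (Ar _ Ax) x0r br.
    have := Ax; rewrite /A /closed_ball_/= => h1 h2.
    have h3 : `|K (H x0 b)| <= r / 4.
      apply: le_trans (Kk _) _; rewrite mulrC -ler_pdivlMr//.
      by rewrite -mulrA -invfM; exact: Hd.
    have -> : x0 - (x - K (H x b)) =
      - (x - x0 - K (H x b - H x0 b)) + K (H x0 b).
      by rewrite (linearB K) opprB [in RHS]opprB addrAC subrK opprB addrCA.
    rewrite (le_trans (ler_normD _ _))// normrN.
    rewrite distrC in h1; lra.
  have [] := @banach_fixed_point R V A [fun of mkfun fA].
  - exists (NngNum (ltW half_gt0)); split=> /=; first by lra.
    move=> [x y] [/= /Ar xr /Ar yr]; apply: le_trans (dist _ _ _ xr yr br).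
    by rewrite /= /mkfun (linearB K) !opprB [K (H y b) - y]addrC addrACA
         [- _ + K _]addrC.
  - exact: closed_closed_ball_.
  - by exists x0; rewrite /A /closed_ball_/= subrr normr0; lra.
  - move=> x Ax /= e; exists x => _; split; first exact: Ar.
    have : K (H x b) = 0.
      by rewrite -[LHS](subKr x) [X in x - X](esym e) subrr.
    by move=> KH; apply: (can_inj KJ); rewrite KH linear0.
have [xs hxs] := choice ex.
exists d, xs; split; first by rewrite lt_min d10.
move=> b bd; have [xr Hx0] := hxs _ bd; have br := dr _ bd.
split => //; first by move=> x xr' Hx; apply: (uniq _ _ b).
apply/cvgrPdist_le => e e0.
have /cvgrPdist_le/(_ (e / (2 * k))) := Hc _ _ xr br.
rewrite divr_gt0 ?mulr_gt0// => /(_ isT) he.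
near=> c.
have cd : `|c - b0| < d.
  near: c; apply/nbhs_ballP; exists (d - `|b - b0|); rewrite /= ?subr_gt0//.
  move=> c; rewrite -ball_normE /= distrC => h.
  by have := ler_distD b c b0; lra.
have [cr Hc0] := hxs _ cd.
have cr' := dr _ cd.
apply: le_trans (dist2 _ _ _ xr cr cr') _.
rewrite mulrC -ler_pdivlMr ?mulr_gt0// Hc0 -Hx0 distrC; near: c.
exact: he.
Unshelve. all: by end_near. Qed.
(** * Finite dimension and strict differentiability *)

(** Finite dimension, as an expansion whose coefficients are dominated by the
    norm: coordinates and norm are then compared without the equivalence of
    norms, and products are immediate. *)
Definition has_coordinates (R : realType) (V : normedModType R) : Prop :=
  exists (I : finType) (e : I -> V) (c : I -> {linear V -> R}),
    (forall i v, `|c i v| <= `|v|) /\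
    (forall v, v = \sum_i c i v *: e i).

Lemma has_coordinates_scalar (R : realType) : has_coordinates R.
Proof.
exists unit, (fun=> 1), (fun=> idfun : {linear R -> R}); split=> // v.
by rewrite big_const card_unit /= addr0 [RHS]mulr1.
Qed.

Lemma has_coordinates_mx (R : realType) (m n : nat) :
  has_coordinates 'M[R]_(m, n).
Proof.
have coord (ij : 'I_m * 'I_n) :
    {c : {linear 'M[R]_(m, n) -> R} | forall A, c A = A ij.1 ij.2}.
  unshelve eexists.
    exists (fun A : 'M[R]_(m, n) => A ij.1 ij.2).
    by do 2![eexists]; do ?[constructor];
       rewrite ?mxE// => ? *; rewrite ?mxE//; move=> ?; rewrite !mxE.
  by [].
exists ('I_m * 'I_n)%type, (fun ij => delta_mx ij.1 ij.2),
  (fun ij => projT1 (coord ij)); split.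
  move=> ij A; rewrite (projT2 (coord ij)).
  rewrite [`|A|]mx_normrE.
  exact: (le_bigmax _ (fun ij => `|A ij.1 ij.2|)).
move=> A; rewrite [LHS]matrix_sum_delta pair_bigA /=.
by apply: eq_bigr => ij _; rewrite (projT2 (coord ij)).
Qed.

Lemma has_coordinates_prod (R : realType) (V W : normedModType R) :
  has_coordinates V -> has_coordinates W -> has_coordinates (V * W)%type.
Proof.
move=> [I [e [c [cV Ve]]]] [J [f [d [dW Wf]]]].
have c1 i : {c' : {linear (V * W)%type -> R} | forall z, c' z = c i z.1}.
  by exists (c i \o fst).
have d1 j : {d' : {linear (V * W)%type -> R} | forall z, d' z = d j z.2}.
  by exists (d j \o snd).
exists (I + J)%type,
  (fun k => match k with inl i => (e i, 0) | inr j => (0, f j) end),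
  (fun k => match k with inl i => projT1 (c1 i) | inr j => projT1 (d1 j) end).
split.
  move=> [i|j] [v w]; rewrite prod_normE le_max.
    by rewrite (projT2 (c1 i)) cV.
  by rewrite (projT2 (d1 j)) dW orbT.
move=> [v w]; rewrite big_sumType /=.
under eq_bigr do rewrite (projT2 (c1 _)).
under [X in _ + X]eq_bigr do rewrite (projT2 (d1 _)).
rewrite [in LHS](Ve v) [in LHS](Wf w).
apply/pair_equal_spec.
have fstS K (F : K -> (V * W)%type) s :
    (\sum_(k <- s) F k).1 = \sum_(k <- s) (F k).1.
  exact: (big_morph fst).
have sndS K (F : K -> (V * W)%type) s :
    (\sum_(k <- s) F k).2 = \sum_(k <- s) (F k).2.
  exact: (big_morph snd).
split.
  rewrite fstS [X in _ + X]fstS [X in _ + X]big1 ?addr0//.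
  by move=> ? _; rewrite /= scaler0.
rewrite sndS [X in _ + X]sndS [X in X + _]big1 ?add0r//.
by move=> ? _; rewrite /= scaler0.
Qed.

Section finite_dimension.
Variables (R : realType) (V W : normedModType R).
Hypothesis coordV : has_coordinates V.

Lemma linear_norm_bound (L : {linear V -> W}) :
  exists2 k, 0 < k & forall v, `|L v| <= k * `|v|.
Proof.
have [I [e [c [cV Ve]]]] := coordV.
exists (1 + \sum_i `|L (e i)|); first by rewrite ltr_pwDl// sumr_ge0.
move=> v; rewrite {1}(Ve v) linear_sum (le_trans (ler_norm_sum _ _ _))//.
rewrite mulrDl mul1r (@le_trans _ _ (\sum_i `|L (e i)| * `|v|))//; last first.
  by rewrite mulr_suml lerDr.
by apply: ler_sum => i _; rewrite linearZ normrZ mulrC ler_wpM2l.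
Qed.

Lemma finite_dim_linear_continuous (L : {linear V -> W}) : continuous L.
Proof.
have [k k0 Lk] := linear_norm_bound L.
apply/linear_bounded_continuous/linear_boundedP; near=> r => x.
by rewrite (le_trans (Lk x))// ler_wpM2r//; near: r; apply: nbhs_pinfty_ge.
Unshelve. all: by end_near. Qed.

End finite_dimension.
Section strict_differentiability.
Variables (R : realType) (V W : normedModType R).
Hypotheses (coordV : has_coordinates V) (coordW : has_coordinates W).

(** Continuity of the differential for the operator norm: expanding [v] in
    coordinates reduces it to the continuity of finitely many directional
    derivatives. *)
Lemma C1_derive_near (U : set V) (f : V -> W) (x : V) (e : R) :
  open U -> U x -> C1_on U f -> 0 < e ->
  \forall y \near x, U y /\ forall v, `|'D_v f y - 'D_v f x| <= e * `|v|.
Proof.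
move=> oU Ux f1 e0; have [I [b [c [cV Vb]]]] := coordV.
have [_ Dc] := f1 x Ux.
have n0 : 0 < e / #|I|.+1%:R by rewrite divr_gt0.
have nU : \forall y \near x, U y by exact: open_nbhs_nbhs.
have nD : \forall y \near x, forall i,
    `|'D_(b i) f y - 'D_(b i) f x| <= e / #|I|.+1%:R.
  apply: filter_forall => i.
  by have /cvgrPdistC_le/(_ _ n0) := Dc (b i).
near=> y; have Uy : U y by near: y.
have nDy : forall i, `|'D_(b i) f y - 'D_(b i) f x| <= e / #|I|.+1%:R.
  by near: y.
split => // v; have [dy _] := f1 y Uy; have [dx _] := f1 x Ux.
rewrite !deriveE// {1 2}(Vb v) (linear_sum ('d f y)).
rewrite (linear_sum ('d f x)) -sumrB.
rewrite (le_trans (ler_norm_sum _ _ _))//.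
apply: (@le_trans _ _ (\sum_(i : I) e / #|I|.+1%:R * `|v|)).
  apply: ler_sum => i _; rewrite (linearZZ ('d f y)) (linearZZ ('d f x)).
  rewrite -scalerBr normrZ mulrC.
  by rewrite ler_pM// -!deriveE.
rewrite sumr_const -[leLHS]mulr_natl !mulrA ler_wpM2r// ler_pdivrMr//.
by rewrite mulrC ler_wpM2l ?(ltW e0)// ler_nat.
Unshelve. all: by end_near. Qed.

Definition strictly_differentiable (f : V -> W) (x : V) (L : V -> W) : Prop :=
  forall e : R, 0 < e -> exists2 r, 0 < r & forall y z,
    `|y - x| < r -> `|z - x| < r ->
    `|f y - f z - L (y - z)| <= e * `|y - z|.

Lemma segment_ball (x y z : V) (r t : R) :
  `|y - x| < r -> `|z - x| < r -> 0 <= t <= 1 ->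
  `|z + t *: (y - z) - x| < r.
Proof.
move=> yr zr /andP[t0 t1].
have -> : z + t *: (y - z) - x = (1 - t) *: (z - x) + t *: (y - x).
  rewrite scalerBl scale1r -[RHS]addrA -scalerN -scalerDr opprB addrAC.
  by rewrite [x - z + _]addrC subrKA.
apply: le_lt_trans (ler_normD _ _) _; rewrite !normrZ.
rewrite (ger0_norm t0) ger0_norm ?subr_ge0//.
set M := Num.max `|z - x| `|y - x|.
have Mr : M < r by rewrite gt_max zr.
have zM : (1 - t) * `|z - x| <= (1 - t) * M.
  by rewrite ler_wpM2l ?subr_ge0// le_max lexx.
have yM : t * `|y - x| <= t * M by rewrite ler_wpM2l// le_max lexx orbT.
lra.
Qed.

(** The mean value theorem on the segment from [z] to [y], applied to each
    coordinate of [f], bounds [f y - f z - 'd f x (y - z)] by the variation of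
    the differential near [x]. *)
Lemma C1_strictly_differentiable (U : set V) (f : V -> W) (x : V) :
  open U -> U x -> C1_on U f -> strictly_differentiable f x ('d f x).
Proof.
move=> oU Ux f1 e e0; have [J [b [c [cW Wb]]]] := coordW.
pose s := 1 + \sum_j `|b j|.
have s0 : 0 < s by rewrite ltr_pwDl// sumr_ge0.
have es0 : 0 < e / s by rewrite divr_gt0.
have /nbhs_ballP[r /= r0 rP] := C1_derive_near oU Ux f1 es0.
exists r => // y z yr zr.
have P t : 0 <= t <= 1 -> U (z + t *: (y - z)) /\
    forall v, `|'D_v f (z + t *: (y - z)) - 'D_v f x| <= e / s * `|v|.
  move=> t01; apply: rP; rewrite -ball_normE /= distrC; exact: segment_ball.
have [dx _] := f1 x Ux.
set w := f y - f z - 'd f x (y - z).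
have cw j : `|c j w| <= e / s * `|y - z|.
  have cc : continuous (c j) by exact: finite_dim_linear_continuous.
  pose g t := c j (f (z + t *: (y - z))).
  pose dg t := c j ('D_(y - z) f (z + t *: (y - z))).
  have gd t : 0 <= t <= 1 -> is_derive (t : R) 1 g (dg t).
    move=> t01; have [Ut _] := P t t01; have [dt _] := f1 _ Ut.
    have cd : differentiable (c j) (f (z + t *: (y - z))).
      exact: linear_differentiable.
    have Fd : differentiable (c j \o f) (z + t *: (y - z)).
      exact: differentiable_comp.
    have -> : dg t = 'D_(y - z) (c j \o f) (z + t *: (y - z)).
      by rewrite /dg !deriveE// (diff_comp dt cd) /= diff_lin.
    have gF : (fun h => h^-1 *: ((g \o shift t) (h *: 1) - g t)) =
      (fun h => h^-1 *: (((c j \o f) \o shift (z + t *: (y - z))) (h *: (y - z))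
        - (c j \o f) (z + t *: (y - z)))).
      by apply/funext => h /=; rewrite /g [_%:A]mulr1 scalerDl addrCA.
    apply: DeriveDef; first by rewrite /derivable gF; exact: diff_derivable.
    by rewrite /derive gF.
  have gd' (t : R) : t \in `]0, 1[ -> is_derive t 1 g (dg t).
    by rewrite in_itv/= => /andP[/ltW ? /ltW ?]; apply/gd/andP.
  have gc : {within `[0, 1], continuous g}.
    apply: continuous_in_subspaceT => t; rewrite inE /= in_itv /= => t01.
    have [gt _] := gd t t01.
    by apply: differentiable_continuous; apply/derivable1_diffP.
  have [t] := MVT ltr01 gd' gc.
  rewrite in_itv /= subr0 mulr1 => /andP[/ltW t0 /ltW t1].
  rewrite /g scale1r scale0r addr0 (addrC z) subrK => cg.
  have [_ /(_ (y - z)) h] := P t (introT andP (conj t0 t1)).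
  rewrite /w linearB [c j (f y - f z)]linearB cg /dg -linearB -deriveE//.
  exact: le_trans (cW _ _) _.
rewrite [w in `|w|]Wb (le_trans (ler_norm_sum _ _ _))//.
apply: (@le_trans _ _ (\sum_j `|b j| * (e / s * `|y - z|))).
  by apply: ler_sum => j _; rewrite normrZ mulrC ler_wpM2l.
rewrite -mulr_suml mulrA ler_wpM2r// mulrCA ler_piMr ?(ltW e0)//.
by rewrite ler_pdivrMr// mul1r lerDr.
Qed.

Lemma strictly_differentiable_continuous (f : V -> W) (x : V)
    (L : {linear V -> W}) :
  strictly_differentiable f x L -> exists2 r, 0 < r &
    forall y, `|y - x| < r -> {for y, continuous f}.
Proof.
move=> /(_ 1 ltr01)[r r0 fL]; exists r => // y yr.
have [k k0 kL] := linear_norm_bound coordV L.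
apply/cvgrPdist_le => e e0.
near=> y'.
have y'r : `|y' - x| < r.
  near: y'; apply/nbhs_ballP; exists (r - `|y - x|); rewrite /= ?subr_gt0//.
  move=> c; rewrite -ball_normE /= distrC => h.
  by have := ler_distD y c x; lra.
have yy' : `|y - y'| <= e / (1 + k).
  near: y'; apply/nbhs_ballP; exists (e / (1 + k)).
    by rewrite /= divr_gt0// ltr_wpDl// ltW.
  by move=> c; rewrite -ball_normE /= => /ltW.
have := fL _ _ yr y'r; rewrite mul1r => h.
rewrite -[f y - f y'](subrK (L (y - y'))) (le_trans (ler_normD _ _))//.
have k1 : 0 < 1 + k by lra.
move: yy'; rewrite ler_pdivlMr// => yy'.
by have := kL (y - y'); lra.
Unshelve. all: by end_near. Qed.

End strict_differentiability.
(** * Linearization on a hypersurface *)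

Lemma near_norm (R : realType) (V : normedModType R) (x : V) (P : V -> Prop) :
  (\forall y \near x, P y) <->
  exists2 r, 0 < r & forall y, `|y - x| < r -> P y.
Proof.
split=> [/nbhs_ballP[r /= r0 rP]|[r r0 rP]].
  by exists r => // y yr; apply: rP; rewrite -ball_normE /= distrC.
apply/nbhs_ballP; exists r => //= y; rewrite -ball_normE /= distrC.
exact: rP.
Qed.

Lemma linearization_comp (R : realType) (V W X : normedModType R) (A : set V)
    (f : V -> W) (g : W -> X) (x0 : V)
    (L : {linear V -> W}) (M : {linear W -> X}) :
  has_coordinates V -> has_coordinates W ->
  is_linearization_within A f x0 L -> strictly_differentiable g (f x0) M ->
  is_linearization_within A (g \o f) x0 (M \o L).
Proof.
move=> coordV coordW fL gM e e0.
have [kL kL0 Lk] := linear_norm_bound coordV L.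
have [kM kM0 Mk] := linear_norm_bound coordW M.
pose e1 := e / (2 * kM); pose e2 := e / (2 * (e1 + kL)).
have e10 : 0 < e1 by rewrite divr_gt0// mulr_gt0.
have e1kL : 0 < e1 + kL by rewrite addr_gt0.
have e20 : 0 < e2 by rewrite divr_gt0// mulr_gt0.
have [r r0 gr] := gM _ e20.
have := fL _ e10; rewrite !near_withinE => /near_norm[d d0 fd].
apply/near_norm; exists (Num.min d (r / (e1 + kL))).
  by rewrite lt_min d0 divr_gt0.
move=> y; rewrite lt_min ltr_pdivlMr// => /andP[yd yr] Ay.
have fy := fd y yd Ay.
have fyx : `|f y - f x0| <= (e1 + kL) * `|y - x0|.
  rewrite -[f y - f x0](subrK (L (y - x0))) (le_trans (ler_normD _ _))//.
  by rewrite mulrDl lerD.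
have fyr : `|f y - f x0| < r by rewrite (le_lt_trans fyx)// mulrC.
have f0r : `|f x0 - f x0| < r by rewrite subrr normr0.
have gy := gr _ _ fyr f0r.
have -> : (g \o f) y - (g \o f) x0 - (M \o L) (y - x0) =
    (g (f y) - g (f x0) - M (f y - f x0)) + M (f y - f x0 - L (y - x0)).
  by rewrite [in RHS](linearB M (f y - f x0)) addrA subrK.
have he1 : kM * e1 = e / 2 by rewrite /e1; field; rewrite gt_eqF.
have he2 : e2 * (e1 + kL) = e / 2.
  by rewrite /e2 [2 * _]mulrC invfM mulrA mulrAC divfK ?gt_eqF.
rewrite (le_trans (ler_normD _ _))// [e]splitr mulrDl lerD//.
  by rewrite (le_trans gy)// -he2 -mulrA ler_wpM2l// ltW.
by rewrite (le_trans (Mk _))// -he1 -mulrA ler_wpM2l// ltW.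
Qed.

Section hypersurface.
Variables (R : realType) (V : normedModType R) (coordV : has_coordinates V).
Variables (h : V -> R) (l : {linear V -> R}) (x0 n : V).
Hypotheses (hl : strictly_differentiable h x0 l) (hx0 : h x0 = 0).
Hypothesis ln : l n = 1.

(** The point [y] is sought on the segment
    [x0 + s *: v + c *: n] with [|c| <= eta * s].  Along it [h] is [c] up to an
    error of [eta * s / 2], so [h] changes sign and the intermediate value
    theorem applies. *)
Lemma zero_set_tangent (v : V) (e d : R) : l v = 0 -> 0 < e -> 0 < d ->
  exists (s : R) (y : V), [/\ 0 < s, h y = 0, `|y - x0| < d &
    `|y - x0 - s *: v| <= e * s].
Proof.
move=> lv e0 d0.
have lZ c u : l (c *: u) = c * l u by exact: linearZZ.
have n0 := normr_ge0 n; have v0 := normr_ge0 v.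
pose eta := e / (1 + `|n|).
have eta0 : 0 < eta by rewrite divr_gt0//; lra.
pose m := `|v| + eta * `|n| + 1.
have m0 : 0 < m by rewrite /m; nra.
have em0 : 0 < eta / (2 * m) by rewrite divr_gt0// mulr_gt0.
have [r r0 hr] := hl em0.
have [r' r'0 hc] := strictly_differentiable_continuous coordV hl.
pose D := Num.min d (Num.min r r').
have D0 : 0 < D by rewrite !lt_min d0 r0.
have [s s0 sE] : exists2 s, 0 < s & D = s * m.
  by exists (D / m); rewrite ?divr_gt0 ?divfK ?gt_eqF.
pose y c := x0 + (s *: v + c *: n).
have yx c : y c - x0 = s *: v + c *: n by rewrite addrC /y addKr.
have yn c : `|c| <= eta * s -> `|y c - x0| < D.
  move=> cs; rewrite sE yx (le_lt_trans (ler_normD _ _))// !normrZ.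
  rewrite (gtr0_norm s0).
  have : `|c| * `|n| <= eta * s * `|n| by rewrite ler_wpM2r.
  by rewrite /m; nra.
have hy c : `|c| <= eta * s -> `|h (y c) - c| <= eta * s / 2.
  move=> cs; have := yn c cs; rewrite !lt_min => /and3P[_ yr _].
  have xr : `|x0 - x0| < r by rewrite subrr normr0.
  have := hr _ _ yr xr; rewrite hx0 subr0 yx linearD !lZ lv ln.
  rewrite mulr0 add0r mulr1 => /le_trans; apply.
  have : `|s *: v + c *: n| <= s * m.
    by have := yn c cs; rewrite yx -sE => /ltW.
  move=> /(ler_wpM2l (ltW em0)) /le_trans; apply.
  rewrite le_eqVlt; apply/orP; left; apply/eqP; field.
  by rewrite gt_eqF.
have es0 : 0 < eta * s by rewrite mulr_gt0.
have hcont : {within `[- (eta * s), eta * s], continuous (h \o y)}.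
  apply: continuous_in_subspaceT => c; rewrite inE /= in_itv /= => cs.
  have /yn : `|c| <= eta * s by rewrite ler_norml.
  rewrite !lt_min => /and3P[_ _ yr'].
  apply: continuous_comp; last exact: hc.
  apply: cvgD; first exact: cvg_cst.
  by apply: cvgD; [exact: cvg_cst|apply: cvgZr_tmp; exact: cvg_id].
have [||c] := @IVT R (h \o y) (- (eta * s)) (eta * s) 0 _ hcont.
- lra.
- have h1 := hy (- (eta * s)); have h2 := hy (eta * s).
  rewrite normrN ger0_norm ?(ltW es0)// lexx in h1 h2.
  move: (h1 isT) (h2 isT); rewrite !ler_norml => /andP[_ h3] /andP[h4 _].
  by rewrite /= ge_min le_max; apply/andP; split; apply/orP; [left|right]; lra.
rewrite in_itv/= -ler_norml => cs hyc; exists s, (y c); split => //.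
  by have := yn c cs; rewrite lt_min => /andP[].
rewrite yx addrC addKr normrZ.
apply: (@le_trans _ _ (eta * s * `|n|)); first by rewrite ler_wpM2r.
have -> : e = eta * (1 + `|n|) by rewrite /eta divfK// gt_eqF//; lra.
by nra.
Qed.

(** The difference of two linearizations is [o(y - x0)] for [y] in the zero set,
    and the points of [zero_set_tangent] carry this over to the tangent
    vectors. *)
Lemma linearization_tangent_unique (W : normedModType R) (A : set V)
    (f : V -> W) (L1 L2 : {linear V -> W}) (v : V) :
  (\forall x \near x0, h x = 0 -> A x) ->
  is_linearization_within A f x0 L1 -> is_linearization_within A f x0 L2 ->
  l v = 0 -> L1 v = L2 v.
Proof.
move=> /near_norm[r r0 rA] fL1 fL2 lv.
have [k1 k10 L1k] := linear_norm_bound coordV L1.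
have [k2 k20 L2k] := linear_norm_bound coordV L2.
apply/eqP; rewrite -subr_eq0 -normr_le0; apply/ler_addgt0Pr => c c0.
rewrite add0r.
have v0 := normr_ge0 v.
pose C := 2 * `|v| + 2 + k1 + k2; have C0 : 0 < C by rewrite /C; lra.
pose e := Num.min 1 (c / C).
have e0 : 0 < e by rewrite lt_min ltr01 divr_gt0.
have e1 : e <= 1 by rewrite ge_min lexx.
have ec : e * C <= c by rewrite -ler_pdivlMr// ge_min lexx orbT.
have := fL1 _ e0; rewrite near_withinE => /near_norm[d1 d10 fd1].
have := fL2 _ e0; rewrite near_withinE => /near_norm[d2 d20 fd2].
have d0 : 0 < Num.min r (Num.min d1 d2) by rewrite !lt_min r0 d10.
have [s [y [s0 hy yd ys]]] := zero_set_tangent lv e0 d0.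
move: yd; rewrite !lt_min.
move=> /and3P[/rA/(_ hy) Ay /fd1/(_ Ay) f1 /fd2/(_ Ay) f2].
have yx : `|y - x0| <= s * `|v| + e * s.
  rewrite -[y - x0](subrK (s *: v)) (le_trans (ler_normD _ _))// normrZ.
  by rewrite (gtr0_norm s0) addrC lerD2l.
have D12 : `|L1 (y - x0) - L2 (y - x0)| <= 2 * e * `|y - x0|.
  have -> : L1 (y - x0) - L2 (y - x0) =
     (f y - f x0 - L2 (y - x0)) - (f y - f x0 - L1 (y - x0)).
    by rewrite opprB [RHS]addrC subrKA.
  by rewrite (le_trans (ler_normB _ _))//; lra.
have sv : s *: (L1 v - L2 v) = (L1 (y - x0) - L2 (y - x0)) -
    (L1 (y - x0 - s *: v) - L2 (y - x0 - s *: v)).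
  rewrite (linearB L1 (y - x0)) (linearB L2 (y - x0)).
  rewrite (linearZZ L1) (linearZZ L2).
  by rewrite opprB addrA subrKA opprB addrC subrKA scalerBr.
have : s * `|L1 v - L2 v| <= s * c.
  rewrite -{1}(gtr0_norm s0) -normrZ sv.
  rewrite (le_trans (ler_normB _ _))//.
  have := L1k (y - x0 - s *: v); have := L2k (y - x0 - s *: v).
  have := ler_normB (L1 (y - x0 - s *: v)) (L2 (y - x0 - s *: v)).
  move=> h1 h2 h3.
  have h4 : k1 * `|y - x0 - s *: v| <= k1 * (e * s) by rewrite ler_wpM2l// ltW.
  have h5 : k2 * `|y - x0 - s *: v| <= k2 * (e * s) by rewrite ler_wpM2l// ltW.
  have h6 : 2 * e * `|y - x0| <= 2 * e * (s * `|v| + e * s).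
    by rewrite ler_wpM2l// mulr_ge0// ltW.
  have h7 : e * s * e <= e * s * 1 by rewrite ler_wpM2l// mulr_ge0 ?ltW.
  have h8 : s * (e * C) <= s * c by rewrite ler_wpM2l// ltW.
  have h9 : s * (e * C) =
      2 * e * (s * `|v|) + 2 * (e * s) + k1 * (e * s) + k2 * (e * s).
    by rewrite /C; ring.
  lra.
by rewrite ler_pM2l.
Qed.

End hypersurface.
(** * Fixed points of a parametrized map of a hypersurface *)

(** A property of finite dimensional spaces, isolated because it concerns the
    algebraic structure only, whereas completeness and the norm come from
    another branch of the hierarchy. *)
Definition injective_endo_invertible (R : realType) (V : lmodType R) : Prop :=
  forall J : {linear V -> V}, injective J ->
    exists K : {linear V -> V}, cancel J K /\ cancel K J.

Lemma vect_injective_endo_invertible (R : realType) (V : vectType R) :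
  injective_endo_invertible V.
Proof.
move=> J Jinj; have J0 : lker (linfun J) == 0%VS.
  by apply/lker0P => u v; rewrite !lfunE; exact: Jinj.
exists (fun_of_lfun (linfun J)^-1%VF); split=> v.
  by have := lker0_lfunK J0 v; rewrite !lfunE.
by have := lker0_lfunVK J0 v; rewrite lfunE.
Qed.

Section with_level.
Variables (R : realType) (V : normedModType R).
Variables (l : {linear V -> R}) (n : V).
Hypothesis ln : l n = 1.

(** The vector on the line through [w] with direction [n] at which [l] takes the
    value [c]. *)
Definition with_level (w : V) (c : R) : V := w - l w *: n + c *: n.

Lemma with_level_linear a w1 c1 w2 c2 :
  with_level (a *: w1 + w2) (a * c1 + c2) =
  a *: with_level w1 c1 + with_level w2 c2.
Proof.
have lZ c u : l (c *: u) = c * l u by exact: linearZZ.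
rewrite /with_level linearD lZ !scalerDl opprD -!scalerA !scalerDr scalerN.
by rewrite [X in X + _ = _]addrACA [LHS]addrACA.
Qed.

Lemma with_levelB w1 c1 w2 c2 :
  with_level w1 c1 - with_level w2 c2 = with_level (w1 - w2) (c1 - c2).
Proof.
rewrite addrC -scaleN1r -with_level_linear scaleN1r mulN1r.
by rewrite addrC [- c2 + _]addrC.
Qed.

Lemma level_with_level w c : l (with_level w c) = c.
Proof.
have lZ d u : l (d *: u) = d * l u by exact: linearZZ.
by rewrite linearD linearB !lZ ln !mulr1 subrr add0r.
Qed.

Lemma with_level0 : with_level 0 0 = 0.
Proof. by rewrite /with_level linear0 !scale0r subr0 addr0. Qed.

Lemma with_level_eq0 w c : with_level w c = 0 -> c = 0 /\ w = l w *: n.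
Proof.
move=> wc0; have c0 : c = 0 by rewrite -(level_with_level w c) wc0 linear0.
by move: wc0; rewrite /with_level c0 scale0r addr0 => /subr0_eq.
Qed.

Lemma with_level_norm k w c : (forall v, `|l v| <= k * `|v|) ->
  `|with_level w c| <= (1 + k * `|n|) * `|w| + `|c| * `|n|.
Proof.
move=> lk; rewrite (le_trans (ler_normD _ _))// normrZ lerD2r.
rewrite (le_trans (ler_normB _ _))// normrZ mulrDl mul1r lerD2l.
by rewrite mulrAC ler_wpM2r.
Qed.

End with_level.

Section fixed_points.
Variables (R : realType) (V : completeNormedModType R) (B : normedModType R).
Variables (S : set V) (h : V -> R) (l : {linear V -> R}) (n x0 : V) (b0 : B).
Variables (P : V -> B -> V) (U : set (V * B)) (F : V * B -> V).
Hypotheses (coordV : has_coordinates V) (coordB : has_coordinates B).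
Hypotheses (hl : strictly_differentiable h x0 l) (ln : l n = 1).
Hypothesis S_h0 : forall x, S x -> h x = 0.
Hypothesis h0_S : \forall x \near x0, h x = 0 -> S x.
Hypotheses (SP : forall x b, S x -> S (P x b)) (Sx0 : S x0).
Hypothesis Px0 : P x0 b0 = x0.
(* Away from the hypersurface [F] is an arbitrary C^1 extension of the
   displacement [P x b - x]. *)
Hypotheses (oU : open U) (U0 : U (x0, b0)) (F1 : C1_on U F).
Hypothesis FP : forall x b, U (x, b) -> S x -> F (x, b) = P x b - x.

Let coordVB := has_coordinates_prod coordV coordB.

Let sF : strictly_differentiable F (x0, b0) ('d F (x0, b0)).
Proof. exact: C1_strictly_differentiable oU U0 F1. Qed.

(* [DF] is the partial derivative of [F] in the state. *)
Let partial_linear : linear (fun v : V => 'd F (x0, b0) (v, 0)).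
Proof.
move=> a u v; rewrite -(linearP ('d F (x0, b0))); congr ('d F (x0, b0) _).
by apply/pair_equal_spec; rewrite /= scaler0 addr0.
Qed.

Let DF : {linear V -> V} := HB.pack (fun v : V => 'd F (x0, b0) (v, 0))
  (GRing.isLinear.Build _ _ _ _ _ partial_linear).

Let norm_pair x b d :
  `|x - x0| < d -> `|b - b0| < d -> `|(x, b) - (x0, b0)| < d.
Proof. by move=> xd bd; rewrite prod_normE gt_max xd. Qed.

Let partial_strict e : 0 < e -> exists2 r, 0 < r & forall x y b,
  `|x - x0| < r -> `|y - x0| < r -> `|b - b0| < r ->
  `|F (x, b) - F (y, b) - DF (x - y)| <= e * `|x - y|.
Proof.
move=> e0; have [r r0 Fr] := sF e0; exists r => // x y b xr yr br.
have := Fr _ _ (norm_pair xr br) (norm_pair yr br).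
have -> : (x, b) - (y, b) = (x - y, 0) :> (V * B)%type.
  by apply/pair_equal_spec; rewrite /= subrr.
by rewrite [X in _ <= e * X]prod_normE /= normr0 max_l.
Qed.

Let linearizationP : is_linearization_within S (P ^~ b0) x0 (idfun \+ DF).
Proof.
move=> e e0; have [r r0 Fr] := partial_strict e0.
have /near_norm[rU rU0 UP] : \forall z \near (x0, b0), U z.
  exact: open_nbhs_nbhs.
rewrite near_withinE; apply/near_norm; exists (Num.min r rU).
  by rewrite lt_min r0.
move=> y; rewrite lt_min => /andP[yr yU] Sy.
have bU : `|b0 - b0| < rU by rewrite subrr normr0.
have := Fr y x0 b0 yr; rewrite !subrr !normr0 => /(_ r0 r0).
rewrite FP//; last exact/UP/norm_pair.
rewrite FP// Px0 subrr subr0.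
suff -> : P y b0 - x0 - (idfun \+ DF) (y - x0) =
  P y b0 - y - DF (y - x0) by [].
by rewrite [(idfun \+ DF) _]/(y - x0 + DF (y - x0)) opprD addrA opprB subrKA.
Qed.

(* [J] is the partial derivative at [(x0, b0)] of the map
   [with_level (F (x, b)) (h x)], whose zeros will be the fixed points. *)
Let J_linear : linear (fun v => with_level l n (DF v) (l v)).
Proof.
by move=> a u v; rewrite -with_level_linear !linearP.
Qed.

Let J : {linear V -> V} := HB.pack (fun v => with_level l n (DF v) (l v))
  (GRing.isLinear.Build _ _ _ _ _ J_linear).

(* A kernel vector is tangent to the hypersurface, where the derivative of the
   displacement is [L - 1]; and [L] preserves tangent vectors because [P] maps
   the hypersurface to itself. *)
Let derivative_injective (L : {linear V -> V}) :
  is_linearization_within S (P ^~ b0) x0 L ->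
  (forall v, l v = 0 -> L v = v -> v = 0) -> injective J.
Proof.
move=> PL L1; have hx0 : h x0 = 0 by exact: S_h0.
have LD v : l v = 0 -> L v = v + DF v.
  exact: (linearization_tangent_unique coordV hl hx0 ln h0_S PL linearizationP).
have lL v : l v = 0 -> l (L v) = 0.
  have lhP : is_linearization_within S (h \o P ^~ b0) x0 (l \o L).
    by apply: linearization_comp => //; rewrite Px0.
  have hP0 : is_linearization_within S (h \o P ^~ b0) x0
      (\0 : {linear V -> R}).
    move=> e e0; rewrite near_withinE; apply: nearW => y Sy.
    rewrite /= !S_h0//; [|exact: SP..].
    by rewrite !subr0 normr0 mulr_ge0// ltW.
  exact: (linearization_tangent_unique coordV hl hx0 ln h0_S lhP hP0).
suff J0 v : J v = 0 -> v = 0.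
  move=> u v uv; apply/eqP; rewrite -subr_eq0; apply/eqP/J0.
  by rewrite linearB uv subrr.
move=> /(with_level_eq0 ln)[lv DFv].
have lD : l (DF v) = 0.
  by have := lL v lv; rewrite LD// linearD lv add0r.
by apply: L1 => //; rewrite LD// DFv lD scale0r addr0.
Qed.

(** The implicit function theorem for [with_level (F (x, b)) (h x)].  At a zero
    [F (x, b)] is a multiple of [n], so that the two points [x] and [P x b] of
    the hypersurface differ along [n]; it vanishes because [h] is strictly
    monotone in that direction. *)
Theorem fixed_points_on_hypersurface (L : {linear V -> V}) :
  injective_endo_invertible V ->
  is_linearization_within S (P ^~ b0) x0 L ->
  (forall v, l v = 0 -> L v = v -> v = 0) ->
  exists (N : set V) (delta : R) (xs : B -> V),
    [/\ open N /\ N x0, 0 < delta,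
        forall b, ball b0 delta b ->
          [/\ S (xs b), N (xs b), P (xs b) b = xs b &
              forall x, S x -> N x -> P x b = x -> x = xs b] &
        {within ball b0 delta, continuous xs}].
Proof.
move=> invV PL L1; have hx0 : h x0 = 0 by exact: S_h0.
have [K [JK KJ]] := invV J (derivative_injective PL L1).
have [k k0 Kk] := linear_norm_bound coordV K.
have [kl kl0 lk] := linear_norm_bound coordV l.
pose H x b := with_level l n (F (x, b)) (h x).
have n0 := normr_ge0 n.
have nl0 : 0 < 1 + kl * `|n| by rewrite ltr_pwDl// mulr_ge0// ltW.
have n10 : 0 < 1 + `|n| by rewrite ltr_pwDl.
have half_gt0 : 0 < 2^-1 :> R by [].
(* Each of the two parts of [H], the transported one and the level, may use
   half of the Lipschitz constant [1 / (2 k)]. *)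
have k40 : 0 < (4 * k)^-1 by rewrite invr_gt0 mulr_gt0.
have [r1 r10 sF1] := partial_strict (divr_gt0 k40 nl0).
have [r2 r20 sh2] := hl (divr_gt0 k40 n10).
have [r3 r30 sh3] := hl (divr_gt0 half_gt0 n10).
have r3h : 0 < r3 / 2 by rewrite divr_gt0.
have /near_norm[r4 r40 hS4] := h0_S.
have [r5 r50 cF5] := strictly_differentiable_continuous coordVB sF.
have F00 : F (x0, b0) = 0 by rewrite FP// Px0 subrr.
have /near_norm[r6 r60 UF6] :
    \forall z \near (x0, b0), U z /\ `|F z| < r3 / 2.
  apply: filterI; first exact: open_nbhs_nbhs.
  have F0c : {for (x0, b0), continuous F} by apply: cF5; rewrite subrr normr0.
  have /cvgrPdist_lt/(_ _ r3h) := F0c.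
  by apply: filterS => z; rewrite F00 sub0r normrN.
(* [r3 / 2] bounds both [x - x0] and [F (x, b)], so that [P x b] stays where
   [h] is known to be monotone along [n]. *)
pose r := Num.min (Num.min r1 (Num.min r2 (r3 / 2)))
  (Num.min r4 (Num.min r5 r6)).
have r0 : 0 < r by rewrite !lt_min r10 r20 r3h r40 r50 r60.
have rP (a : R) : a < r ->
    [/\ a < r1, a < r2 & a < r3 / 2] /\ [/\ a < r4, a < r5 & a < r6].
  by rewrite !lt_min => /andP[/and3P[? ? ?] /and3P[? ? ?]].
have HJ x y b : `|x - x0| < r -> `|y - x0| < r -> `|b - b0| < r ->
    `|H x b - H y b - J (x - y)| <= (2 * k)^-1 * `|x - y|.
  move=> /rP[[xr1 xr2 _] _] /rP[[yr1 yr2 _] _] /rP[[br1 _ _] _].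
  rewrite !with_levelB (le_trans (with_level_norm _ _ _ lk))//.
  have -> : (2 * k)^-1 = (4 * k)^-1 + (4 * k)^-1 by field; rewrite gt_eqF.
  rewrite [leRHS]mulrDl lerD//.
    rewrite mulrC -ler_pdivlMr// mulrAC; exact: sF1.
  have := sh2 _ _ xr2 yr2 => /(ler_wpM2r n0) /le_trans; apply.
  rewrite mulrAC ler_wpM2r// mulrAC ler_pdivrMr//.
  by rewrite ler_wpM2l ?(ltW k40)// lerDr.
have Hc x b : `|x - x0| < r -> `|b - b0| < r -> {for b, continuous (H x)}.
  move=> /rP[_ [_ xr5 _]] /rP[_ [_ br5 _]].
  have cF : {for b, continuous (fun c => F (x, c))}.
    apply: (@continuous_comp _ _ _ (fun c => (x, c)) F).
      by apply: cvg_pair; [exact: cvg_cst|exact: cvg_id].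
    exact/cF5/norm_pair.
  rewrite /prop_for /continuous_at /H; apply: cvgD; last exact: cvg_cst.
  apply: cvgB; first exact: cF.
  apply: cvgZr_tmp; apply: (continuous_comp cF).
  exact: finite_dim_linear_continuous.
have H00 : H x0 b0 = 0 by rewrite /H F00 hx0 with_level0.
have [delta [xs [d0 xsP]]] := implicit_function k0 r0 JK KJ Kk HJ Hc H00.
pose d := Num.min delta r.
have ballE b : ball b0 d b -> `|b - b0| < delta /\ `|b - b0| < r.
  by rewrite -ball_normE /= distrC lt_min => /andP.
exists (ball x0 r), d, xs; split.
- by split; [exact: ball_open|exact: ballxx].
- by rewrite lt_min d0.
- move=> b /ballE[bd br]; have [xr Hxs xsu _] := xsP b bd.
  have [hx Fn] := with_level_eq0 ln Hxs.
  have [[_ _ xr3] [xr4 _ xr6]] := rP _ xr.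
  have [_ [_ _ br6]] := rP _ br.
  have [Uxs Fr3] := UF6 _ (norm_pair xr6 br6).
  have Sx : S (xs b) by exact: hS4.
  have PxF : F (xs b, b) = P (xs b) b - xs b by exact: FP.
  have F0 : F (xs b, b) = 0.
    have Pr3 : `|P (xs b) b - x0| < r3.
      rewrite -(subrKA (xs b)) -PxF (le_lt_trans (ler_normD _ _))//.
      lra.
    have xsr3 : `|xs b - x0| < r3 by lra.
    have := sh3 _ _ Pr3 xsr3.
    rewrite -PxF hx (S_h0 (SP b Sx)) subrr sub0r normrN.
    rewrite [in X in _ <= X]Fn normrZ.
    set s := `|l _| => sle.
    have q1 : 2^-1 / (1 + `|n|) * `|n| <= 2^-1.
      by rewrite mulrAC ler_pdivrMr// ler_wpM2l ?(ltW half_gt0)// lerDr.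
    have s0 : 0 <= s by exact: normr_ge0.
    have := ler_wpM2l s0 q1 => sq.
    have s00 : s = 0 by lra.
    by move/eqP: s00; rewrite normr_eq0 => /eqP lF0; rewrite Fn lF0 scale0r.
  split => //.
  + by rewrite -ball_normE /= distrC.
  + by apply/eqP; rewrite -subr_eq0 -PxF F0.
  + move=> x Sxx; rewrite -ball_normE /= distrC => xxr Pxb.
    apply: xsu => //; have [_ [_ _ xxr6]] := rP _ xxr.
    have [Ux _] := UF6 _ (norm_pair xxr6 br6).
    by rewrite /H FP// Pxb subrr S_h0// with_level0.
- by apply: continuous_in_subspaceT => b; rewrite inE => /ballE[/xsP[]].
Qed.

End fixed_points.
(** * The switching surface of the biped *)

(** The inequality in the definition of the switching surface is an open
    condition: the foot velocity is jointly continuous in position and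
    velocity. *)
Lemma switching_near (R : realType) (M : biped R) (x : state R) :
  biped_axioms M -> switching M x ->
  \forall y \near x, foot_height M y.1 = 0 -> switching M y.
Proof.
move=> hM [Qx px Dx].
have coordQ := @has_coordinates_mx R 5 1.
have [dp _] := foot_height_C1 hM Qx.
pose a := - 'D_(x.2) (foot_height M) x.1; have a0 : 0 < a by rewrite oppr_gt0.
have [k k0 pk] :=
  linear_norm_bound coordQ ('d (foot_height M) (x.1 : 'cV[R]_5)).
pose e := a / 3 / (`|x.2| + 1).
have x20 : 0 < `|x.2| + 1 by rewrite ltr_pwDr.
have e0 : 0 < e by rewrite !divr_gt0.
have /near_norm[r r0 Dr] := C1_derive_near coordQ (config_open hM) Qx
  (foot_height_C1 hM) e0.
apply/near_norm; exists (Num.min r (Num.min 1 (a / 3 / k))).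
  by rewrite !lt_min r0 ltr01 !divr_gt0.
move=> y; rewrite prod_normE !gt_max !lt_min.
move=> /andP[/and3P[yr _ _] /and3P[_ y1 yk]] py.
have [Qy Dy] := Dr _ yr; split => //.
move: yk; rewrite ltr_pdivlMr// mulrC => yk.
have := Dy y.2; have := pk (y.2 - x.2).
have y2 : `|y.2| <= `|x.2| + 1.
  by rewrite -[y.2](subrK x.2) addrC (le_trans (ler_normD _ _))// lerD2l ltW.
have := ler_wpM2l (ltW e0) y2; rewrite /e divfK ?gt_eqF// -/e.
have Dxy : 'd (foot_height M) (x.1 : 'cV[R]_5) (y.2 - x.2) =
    'D_(y.2) (foot_height M) x.1 + a.
  by rewrite linearB /= /a !deriveE.
rewrite Dxy !ler_norml => h1 /andP[_ h2] /andP[_ h3].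
have h4 := le_trans h2 (ltW yk).
lra.
Qed.
Theorem proposition1 (R : realType) (M : biped R) (p : nat)
    (g : gait_design R p) (tk : R)
    (tau : 'cV[R]_p -> state R -> \bar R)
    (phi : 'cV[R]_p -> state R -> R -> state R)
    (xstar : state R) (L : {linear state R -> state R})
    (hM : biped_axioms M)
    (hg : gait_axioms M g)
    (hphi : is_closed_loop_flow M g tk tau phi)
    (hP : poincare_well_defined M g tk tau phi)
    (hC1 : C1_on_submanifold
       (switching M `*` [set: 'cV[R]_p] : set (state R * 'cV[R]_p)%type)
       (fun z : (state R * 'cV[R]_p)%type =>
          poincare M tk tau phi z.1 z.2 - z.1))
    (hxS : switching M xstar)
    (hfix : poincare M tk tau phi xstar 0 = xstar)
    (hgait : monotone_step M g tk tau phi xstar)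
    (hL : is_linearization_within (switching M)
            (fun x => poincare M tk tau phi x 0) xstar L)
    (heig : ~ has_eigenvalue_on (switching_tangent M xstar) L 1) :
  exists (N : set (state R)) (delta : R) (xs : 'cV[R]_p -> state R),
    [/\ open N /\ N xstar,
        0 < delta,
        forall b, ball 0 delta b ->
          [/\ switching M (xs b), N (xs b),
              poincare M tk tau phi (xs b) b = xs b &
              forall x, switching M x -> N x ->
                poincare M tk tau phi x b = x -> x = xs b] &
        {within ball (0 : 'cV[R]_p) delta, continuous xs}].
Proof.
move=> {hgait hphi hg}.
have [Qx px Dx] := hxS.
have coordQ := @has_coordinates_mx R 5 1.
have [dp _] := foot_height_C1 hM Qx.
pose l : {linear state R -> R} :=
  'd (foot_height M) (xstar.1 : 'cV[R]_5) \o fst.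
have lE v : l v = 'D_(v.1) (foot_height M) xstar.1 by rewrite /l deriveE.
pose n : state R := (('D_(xstar.2) (foot_height M) xstar.1)^-1 *: xstar.2, 0).
have ln : l n = 1.
  rewrite /l/= [LHS]linearZZ /= -deriveE//.
  by rewrite [LHS]mulVf// lt_eqF.
have pl : strictly_differentiable (foot_height M \o fst) xstar l.
  have coordR := has_coordinates_scalar R.
  move=> e e0; have [r r0 pr] := C1_strictly_differentiable coordQ coordR
    (config_open hM) Qx (foot_height_C1 hM) e0.
  exists r => // y z; rewrite !prod_normE !gt_max.
  move=> /andP[yr _] /andP[zr _]; apply: le_trans (pr _ _ yr zr) _.
  by rewrite ler_wpM2l ?(ltW e0)// le_max lexx.
have [U [F [oU U0 F1 FU]]] := hC1 (xstar, 0) (conj hxS I).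
apply: (fixed_points_on_hypersurface (has_coordinates_prod coordQ coordQ)
  (@has_coordinates_mx R p 1) pl ln _ (switching_near hM hxS) _ hxS hfix oU U0
  F1 _ _ hL).
- by move=> x [].
- by move=> x b /(hP x b)[].
- by move=> x b Uxb Sx; rewrite FU.
- exact: vect_injective_endo_invertible.
- move=> v lv Lv; apply/eqP/negP => v0; apply: heig; exists v.
  split; [exact: etrans (esym (lE v)) lv|exact/negP|by rewrite scale1r].
Qed.
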